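(* When $\mu_I<\mu_E$, the Inelastic-First policy $\mathrm{IF}$ is in general not optimal for minimizing mean response time: there exist a system instance with $\mu_I<\mu_E$ and an allocation policy $\pi$ such that the mean response time under $\pi$ is strictly smaller than the mean response time under $\mathrm{IF}$.
   Context: Model. There are $k$ identical servers, each processing work at rate $1$. Inelastic jobs arrive according to a Poisson process of rate $\lambda_I\ge0$ and elastic jobs according to an independent Poisson process of rate $\lambda_E\ge0$. Job sizes (amounts of inherent work) are independent of each other and of the arrivals, $\mathrm{Exp}(\mu_I)$ for inelastic jobs and $\mathrm{Exp}(\mu_E)$ for elastic jobs, and are unknown to the scheduler. Jobs are preemptible, and fractional allocations are allowed. A job allocated $n\in\mathbb{R}_{\ge0}$ servers is processed at rate $n$. An inelastic job may be allocated at most $1$ server at any time; an elastic job may be allocated any number of servers; in total at most $k$ servers are allocated. A job leaves when its remaining size is $0$. Allocation policies. State $(i,j)$ means $i$ inelastic and $j$ elastic jobs in the system. Policies are stationary and deterministic: in each state $(i,j)\in\mathbb{Z}_{\ge0}^2$ policy $\pi$ allocates a total of $\pi_I(i,j)\ge0$ servers to inelastic jobs and $\pi_E(i,j)\ge0$ servers to elastic jobs, with $\pi_I(i,j)\le i$, $\pi_E(i,j)\le k\mathbf{1}_{\{j>0\}}$, $\pi_I(i,j)+\pi_E(i,j)\le k$. The number of jobs of each type evolves as a continuous-time Markov chain with transitions from $(i,j)$ to $(i+1,j)$, $(i,j+1)$, $(i-1,j)$, $(i,j-1)$ at rates $\lambda_I$, $\lambda_E$, $\pi_I(i,j)\mu_I$,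 $\pi_E(i,j)\mu_E$ respectively. Inelastic-First ($\mathrm{IF}$): strict preemptive priority to inelastic jobs, first-come-first-served within each class. In state $(i,j)$ with $i<k$, each inelastic job gets one server and the remaining $k-i$ servers go to the elastic job with the earliest arrival time, if there is one; if $i\ge k$, the $k$ inelastic jobs with the earliest arrival times get one server each. Instances and mean response time. An instance consists of $k,\mu_I,\mu_E,\lambda_I,\lambda_E$ and an initial state $(i_0,j_0)$. Instances with no arrivals ($\lambda_I=\lambda_E=0$) and a nonempty finite set of jobs present at time $0$ are allowed; in that case the mean response time is the expectation of the average, over these initial jobs, of their completion times. With arrivals, it is the mean, in steady state, of the time from a job's arrival to its completion. *)

(* Defs.v *)
(* MathComp-Analysis *)
From Stdlib Require List.
From HB Require Import structures.
From mathcomp Require Import all_boot all_order all_algebra.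
From mathcomp Require Import all_classical all_reals all_analysis.

Set Implicit Arguments.
Unset Strict Implicit.
Unset Printing Implicit Defensive.
Import Order.TTheory GRing.Theory Num.Theory.
Import numFieldNormedType.Exports.
Local Open Scope classical_set_scope.
Local Open Scope ring_scope.

Variant job_class := Inelastic | Elastic.

Definition is_elastic (c : job_class) : bool :=
  if c is Elastic then true else false.
Definition class_of_bool (b : bool) : job_class :=
  if b then Elastic else Inelastic.
Lemma is_elasticK : cancel is_elastic class_of_bool.
Proof. by case. Qed.
HB.instance Definition _ := Equality.copy job_class (can_type is_elasticK).

Record instance (R : realType) := Instance {
  servers : nat;
  mu : job_class -> R;
  lambda : job_class -> R;
  initial : job_class -> nat;
  servers_gt0 : (0 < servers)%N;
  mu_gt0 : forall c, 0 < mu c;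
  lambda_ge0 : forall c, 0 <= lambda c;
  initial_or_arrivals : (forall c, lambda c = 0) ->
    (0 < initial Inelastic + initial Elastic)%N }.

Record policy (R : realType) (k : nat) := Policy {
  alloc : job_class -> nat -> nat -> R;
  alloc_ge0 : forall c i j, 0 <= alloc c i j;
  alloc_inelastic : forall i j, alloc Inelastic i j <= i%:R;
  alloc_elastic : forall i j,
    alloc Elastic i j <= if (0 < j)%N then k%:R else 0;
  alloc_total : forall i j, alloc Inelastic i j + alloc Elastic i j <= k%:R }.

Section InelasticFirst.
Variables (R : realType) (k : nat).

Definition if_alloc (c : job_class) (i j : nat) : R :=
  match c with
  | Inelastic => (minn i k)%:R
  | Elastic => if (0 < j)%N then (k - i)%:R else 0
  end.

Fact if_alloc_ge0 c i j : 0 <= if_alloc c i j.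
Proof. by case: c => /=; [|case: ifP]. Qed.

Fact if_alloc_inelastic i j : if_alloc Inelastic i j <= i%:R.
Proof. by rewrite ler_nat geq_minl. Qed.

Fact if_alloc_elastic i j :
  if_alloc Elastic i j <= if (0 < j)%N then k%:R else 0.
Proof. by rewrite /=; case: ifP => // _; rewrite ler_nat leq_subr. Qed.

Fact if_alloc_total i j :
  if_alloc Inelastic i j + if_alloc Elastic i j <= k%:R.
Proof.
rewrite /=; case: ifP => _; last by rewrite addr0 ler_nat geq_minr.
by rewrite -natrD ler_nat minnC minnE subnK // leq_subr.
Qed.

Definition inelastic_first : policy R k :=
  Policy if_alloc_ge0 if_alloc_inelastic if_alloc_elastic if_alloc_total.

End InelasticFirst.

(* The primitive random quantities: [inl (c, m)] is the size of the [m]-th job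
   of class [c] (initial jobs first, then arrivals in order), and [inr (c, m)]
   is the time between the [m]-th arrival of class [c] (the time origin for
   [m = 0]) and the next one. *)
Definition source := (job_class * nat + job_class * nat)%type.

Record job (R : realType) := Job {
  class : job_class;
  ident : nat;  (* initial jobs first, then arrivals of both classes in order *)
  arrived : R;
  remaining : R }.

Record state (R : realType) := State {
  clock : R;
  present : seq (job R);
  entered : job_class -> nat }.

Section Path.
Variables (R : realType) (sys : instance R) (pi : policy R (servers sys)).
Variable x : source -> R.

Definition arrival_epoch (c : job_class) (m : nat) : \bar R :=
  if lambda sys c == 0 then +oo%E else (\sum_(l < m.+1) x (inr (c, l : nat)))%:E.

Definition class_count (s : state R) (c : job_class) : nat :=
  count (fun y => class y == c) (present s).

Definition rank (s : state R) (y : job R) : nat :=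
  count (fun z => (class z == class y) && (ident z < ident y)%N) (present s).

(* The policy fixes the total allocation of each class only; within a class it
   is handed out first-come-first-served, with at most one server to each
   inelastic job and no limit for an elastic job. Sizes being exponential, the
   mean response time does not depend on this choice. *)
Definition share (s : state R) (y : job R) : R :=
  let i := class_count s Inelastic in
  let j := class_count s Elastic in
  let a := alloc pi (class y) i j in
  match class y with
  | Inelastic => Num.max 0 (Num.min 1 (a - (rank s y)%:R))
  | Elastic => if rank s y == 0%N then a else 0
  end.

Definition finish (s : state R) (y : job R) : \bar R :=
  if 0 < share s y then (clock s + remaining y / share s y)%:E else +oo%E.

Definition next_arrival (s : state R) (c : job_class) : \bar R :=
  arrival_epoch c (entered s c - initial sys c).

Definition next_event (s : state R) : \bar R :=
  Order.min (Order.min (next_arrival s Inelastic) (next_arrival s Elastic))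
    (\big[Order.min/+oo%E]_(y <- present s) finish s y).

Definition serve (s : state R) (t : R) : state R :=
  State t
    [seq Job (class y) (ident y) (arrived y)
           (remaining y - share s y * (t - clock s))
       | y <- present s & finish s y != t%:E]
    (entered s).

Definition enter (c : job_class) (s : state R) : state R :=
  if next_arrival s c == (clock s)%:E then
    State (clock s)
      (rcons (present s)
         (Job c (entered s Inelastic + entered s Elastic) (clock s)
              (x (inl (c, entered s c)))))
      (fun c' => (entered s c' + (c' == c))%N)
  else s.

Definition step (s : state R) : state R :=
  if next_event s is t%:E then enter Elastic (enter Inelastic (serve s t))
  else s.

Definition initial_state : state R :=
  State 0
    ([seq Job Inelastic m 0 (x (inl (Inelastic, m)))
        | m <- iota 0 (initial sys Inelastic)] ++
     [seq Job Elastic (initial sys Inelastic + m) 0 (x (inl (Elastic, m)))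
        | m <- iota 0 (initial sys Elastic)])
    (initial sys).

Definition trajectory (n : nat) : state R := iter n step initial_state.

(* Time from arrival to completion; [+oo] if job [m] never completes. *)
Definition response_time (m : nat) : \bar R :=
  ereal_inf [set t | exists n y,
    [/\ List.In y (present (trajectory n)), ident y = m,
        finish (trajectory n) y = next_event (trajectory n) &
        t = (finish (trajectory n) y - (arrived y)%:E)%E]].

End Path.

Section MeanResponseTime.
Variables (R : realType) (sys : instance R).

Definition rate (s : source) : R :=
  match s with inl (c, _) => mu sys c | inr (c, _) => lambda sys c end.

(* The primitives that the system uses: with [lambda sys c = 0] there are no
   interarrival times and only the initial jobs have sizes. *)
Definition in_use (s : source) : bool :=
  match s with
  | inl (c, m) => (m < initial sys c)%N || (0 < lambda sys c)
  | inr (c, _) => 0 < lambda sys c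
  end.

Definition mutually_independent d (T : measurableType d) (P : probability T R)
    (I : eqType) (A : pred I) (X : I -> {RV P >-> R}) : Prop :=
  forall (J : seq I) (B : I -> set R), uniq J -> all A J ->
    (forall s, measurable (B s)) ->
    P (\bigcap_(s in [set` J]) (X s @^-1` B s)) =
    (\prod_(s <- J) P (X s @^-1` B s))%E.

Record realization d (T : measurableType d) (P : probability T R) :=
  Realization {
    draw :> source -> {RV P >-> R};
    draw_gt0 : forall s w, 0 < draw s w;
    draw_law : forall s, in_use s -> forall B : set R, measurable B ->
      distribution P (draw s) B = exponential_prob (rate s) B;
    draw_indep : mutually_independent in_use draw }.

Definition initial_jobs : nat := initial sys Inelastic + initial sys Elastic.

(* Without arrivals: expected average completion time of the initial jobs.
   With arrivals, the steady-state mean is the limit, as [m] grows, of the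
   expected response time of the [m]-th arriving job of either class. *)
Definition mean_response_time_in (pi : policy R (servers sys))
    d (T : measurableType d) (P : probability T R) (W : realization P)
    (r : \bar R) : Prop :=
  let resp m w := response_time pi (fun s => W s w) m in
  if (lambda sys Inelastic == 0) && (lambda sys Elastic == 0) then
    r = (\int[P]_w
          ((initial_jobs%:R^-1)%:E * \sum_(m < initial_jobs) resp m w))%E
  else
    (\int[P]_w resp (initial_jobs + m)%N w)%E @[m --> \oo] --> r.

(* The mean response time depends only on the law of the primitives, so any
   realization yields it; the first conjunct keeps the second one from holding
   vacuously. *)
Definition has_mean_response_time (pi : policy R (servers sys)) (r : \bar R)
    : Prop :=
  (exists d (T : measurableType d) (P : probability T R),
     inhabited (realization P)) /\
  (forall d (T : measurableType d) (P : probability T R) (W : realization P),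
     mean_response_time_in pi W r).

End MeanResponseTime.

(* Main.v *)
(* One server and no arrivals: a single inelastic job of mean size 1 and a
   single elastic job of mean size 1/2 are present at time 0. On one server the
   jobs are served one after the other, so the total response time is twice the
   size of the first job plus the size of the second, and the job with the
   smaller mean size, here the elastic one, should go first. *)
From HB Require Import structures.
Require Import Defs.
From mathcomp Require Import all_boot all_order all_algebra.
From mathcomp Require Import all_classical all_reals all_analysis.
From mathcomp Require Import measurable_realfun ring lra.

Set Implicit Arguments.
Unset Strict Implicit.
Unset Printing Implicit Defensive.
Import Order.TTheory GRing.Theory Num.Theory.
Local Open Scope classical_set_scope.
Local Open Scope ring_scope.

(** * The competing policy: strict priority to elastic jobs *)

Section ElasticFirst.
Variables (R : realType) (k : nat).

Definition ef_alloc (c : job_class) (i j : nat) : R :=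
  match c with
  | Inelastic => if (0 < j)%N then 0 else (minn i k)%:R
  | Elastic => if (0 < j)%N then k%:R else 0
  end.

Fact ef_alloc_ge0 c i j : 0 <= ef_alloc c i j.
Proof. by case: c => /=; case: ifP. Qed.

Fact ef_alloc_inelastic i j : ef_alloc Inelastic i j <= i%:R.
Proof. by rewrite /=; case: ifP => // _; rewrite ler_nat geq_minl. Qed.

Fact ef_alloc_elastic i j :
  ef_alloc Elastic i j <= if (0 < j)%N then k%:R else 0.
Proof. by []. Qed.

Fact ef_alloc_total i j :
  ef_alloc Inelastic i j + ef_alloc Elastic i j <= k%:R.
Proof.
by rewrite /=; case: ifP => _; rewrite ?add0r// addr0 ler_nat geq_minr.
Qed.

Definition elastic_first : policy R k :=
  Policy ef_alloc_ge0 ef_alloc_inelastic ef_alloc_elastic ef_alloc_total.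

End ElasticFirst.

(** * Sample paths of the two-job instance *)

Section TwoJobs.
Variable R : realType.

Definition two_jobs_mu (c : job_class) : R := if c is Elastic then 2 else 1.

Fact two_jobs_mu_gt0 c : 0 < two_jobs_mu c.
Proof. by case: c. Qed.

Definition two_jobs : instance R :=
  @Instance R 1 two_jobs_mu (fun=> 0) (fun=> 1%N) isT two_jobs_mu_gt0
    (fun=> lexx 0) (fun=> isT).

Definition other (c : job_class) : job_class :=
  if c is Elastic then Inelastic else Elastic.

(** Here [c] is the class served first, so one computation covers both priority orders. The
    hypotheses fix the allocation in every nonempty state that the path can visit. *)
Variables (pi : policy R 1) (c : job_class).
Hypothesis alloc_c : alloc pi c 1 1 = 1.
Hypothesis alloc_other : alloc pi (other c) 1 1 = 0.
Hypothesis alloc_inelastic_alone : alloc pi Inelastic 1 0 = 1.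
Hypothesis alloc_elastic_alone : alloc pi Elastic 0 1 = 1.

Variable x : source -> R.

Let work c' := x (inl (c', 0%N)).
(** Initial jobs are numbered inelastic first, so the number of each job is this boolean read as 0
    or 1. *)
Let id_of (c' : job_class) : nat := c' == Elastic.
Let init_job c' := Job c' (id_of c') 0 (work c').

Let s0 : state R :=
  State 0 [:: init_job Inelastic; init_job Elastic] (fun=> 1%N).
(** The waiting job receives no service before the first completion, hence still has its full size
    in [s1]. *)
Let last_job := Job (other c) (id_of (other c)) 0 (work (other c)).
Let s1 : state R := State (work c) [:: last_job] (fun=> 1%N).
Let s2 : state R := State (work c + work (other c)) [::] (fun=> 1%N).

Let next_arrivalE s c' : next_arrival two_jobs x s c' = +oo%E.
Proof. by rewrite /next_arrival /arrival_epoch /= eqxx. Qed.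

Let enterE s c' : enter two_jobs x c' s = s.
Proof. by rewrite /enter next_arrivalE. Qed.

Let next_eventE s : next_event (sys := two_jobs) pi x s =
  \big[Order.min/+oo%E]_(y <- present s) finish (sys := two_jobs) pi s y.
Proof. by rewrite /next_event !next_arrivalE !minye. Qed.

Let share0 c' : share (sys := two_jobs) pi s0 (init_job c') = (c' == c)%:R.
Proof.
rewrite /share /class_count /rank /=.
case: c' c alloc_c alloc_other => -[] /= e1 e0; rewrite ?e1 ?e0 ?subr0 //.
- by rewrite minxx maxEle ler01.
- by rewrite minEle ler10 /= maxxx.
Qed.

Let finish0 c' : finish (sys := two_jobs) pi s0 (init_job c') =
  if c' == c then (work c)%:E else +oo%E.
Proof.
rewrite /finish share0; case: eqP => [->|_]; last by rewrite ltxx.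
by rewrite ltr01 divr1 add0r.
Qed.

Let finish1 : finish (sys := two_jobs) pi s1 last_job =
  (work c + work (other c))%:E.
Proof.
have share_last : share (sys := two_jobs) pi s1 last_job = 1.
  rewrite /share /class_count /rank /last_job /=.
  by case: c => /=; rewrite ?alloc_inelastic_alone ?alloc_elastic_alone //=
    subr0 minxx maxEle ler01.
by rewrite /finish share_last ltr01 divr1.
Qed.

Let next_event0 : next_event (sys := two_jobs) pi x s0 = (work c)%:E.
Proof.
rewrite next_eventE /= !big_cons big_nil !finish0.
by case: c => /=; rewrite ?minye ?miney.
Qed.

Let next_event1 : next_event (sys := two_jobs) pi x s1 =
  (work c + work (other c))%:E.
Proof. by rewrite next_eventE /= big_seq1 finish1. Qed.

Let next_event2 : next_event (sys := two_jobs) pi x s2 = +oo%E.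
Proof. by rewrite next_eventE big_nil. Qed.

(** Only completions are events. In [s0] the waiting job has finish time [+oo], so just the job of
    class [c] leaves; [s2] has no next event, which makes it a fixed point of [step]. *)
Let trajectoryE n : trajectory (sys := two_jobs) pi x n =
  match n with 0%N => s0 | 1%N => s1 | _ => s2 end.
Proof.
have step0 : step (sys := two_jobs) pi x s0 = s1.
  rewrite /step next_event0 !enterE /serve /= !finish0 /s1 /last_job.
  by case: c share0 => share0_c /=; rewrite eqxx /= share0_c /= mul0r subr0.
have step1 : step (sys := two_jobs) pi x s1 = s2.
  by rewrite /step next_event1 !enterE /serve /= finish1 eqxx.
elim: n => [//|n IHn]; rewrite /trajectory iterS -/(trajectory _ _ _) IHn.
by case: n {IHn} => [//|[//|n]]; rewrite /step next_event2.
Qed.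

Lemma response_time_served_first :
  response_time (sys := two_jobs) pi x (c == Elastic) = (work c)%:E.
Proof.
rewrite /response_time.
(* The infimum runs over a singleton: this job is present at step 0 only, and completes there. *)
rewrite [X in ereal_inf X](_ : _ = [set (work c)%:E]) ?ereal_inf1 //.
apply/seteqP; split => [t [n [y []]]|_ ->].
- rewrite trajectoryE; case: n => [|[|//]] /=.
  + case=> [<-|[<-|//]] /= idE _ ->; rewrite finish0 sube0.
    * by case: c idE => //= _; rewrite eqxx.
    * by case: c idE => //= _; rewrite eqxx.
  + by case=> [<-|//]; rewrite /last_job /=; case: c.
- exists 0%N, (init_job c); rewrite trajectoryE finish0 eqxx sube0 next_event0.
  by split => //=; case: c; [left|right; left].
Qed.

Lemma response_time_served_last :
  response_time (sys := two_jobs) pi x (other c == Elastic) =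
  (work c + work (other c))%:E.
Proof.
rewrite /response_time.
(* This job is also present at step 0, but its finish time [+oo] is not the next event there, so
   only step 1 contributes. *)
rewrite [X in ereal_inf X](_ : _ = [set (work c + work (other c))%:E])
  ?ereal_inf1 //.
apply/seteqP; split => [t [n [y []]]|_ ->].
- rewrite trajectoryE; case: n => [|[|//]] /=.
  + by case=> [<-|[<-|//]] /=; rewrite finish0 next_event0; case: c.
  + by case=> [<-|//] _ _ ->; rewrite finish1 sube0.
- exists 1%N, last_job; rewrite trajectoryE finish1 sube0 next_event1.
  by split => //=; left.
Qed.

End TwoJobs.

(** * The mean of an exponential variable *)

Section ExponentialMean.
Local Open Scope ereal_scope.
Context d (T : measurableType d) (R : realType) (P : probability T R).

(** The mean of a nonnegative variable is the integral of its tail, and the exponential tail is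
    [rate^-1] times the density, whose integral is 1. *)
Lemma expectation_exponential (rate : R) (X : {RV P >-> R}) :
  (0 < rate)%R -> (forall w, 0 < X w)%R ->
  (forall B, measurable B -> distribution P X B = exponential_prob rate B) ->
  'E_P[X] = (rate^-1)%:E.
Proof.
move=> rate_gt0 X_gt0 lawX.
rewrite ge0_expectation_ccdf; last by move=> w; exact: ltW.
transitivity (\int[lebesgue_measure]_(r in `[0%R, +oo[)
    ((rate^-1)%:E * (exponential_pdf rate r)%:E)).
  apply: eq_integral => r; rewrite inE/= in_itv/= andbT => r_ge0.
  rewrite -EFinM exponential_pdfE// mulKf ?gt_eqF// ccdf_1_cdf.
  (* Positivity of [X] trades the half-line for an interval of known exponential measure. *)
  have -> : cdf X r = distribution P X `[0%R, r].
    rewrite /cdf /distribution /pushforward; congr (P _); apply/seteqP.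
    by split=> w /=; rewrite !in_itv/= (ltW (X_gt0 w)).
  have [r_gt0|] := ltP 0%R r.
    by rewrite lawX// exponential_prob_itv0c// -!EFinB opprB addrC subrK.
  (* The interval degenerates to the point 0, which [X] never hits, so the tail is 1. *)
  move=> r_le0; have -> : r = 0%R by apply/eqP; rewrite eq_le r_le0.
  rewrite mulr0 expR0 set_itv1 /distribution /pushforward.
  rewrite [X @^-1` _](_ : _ = set0) ?measure0 ?sube0//.
  by apply/seteqP; split=> w //= Xw0; have := X_gt0 w; rewrite Xw0 ltxx.
have pdf_ge0 r : 0 <= (exponential_pdf rate r)%:E.
  by rewrite lee_fin exponential_pdf_ge0 ?ltW.
rewrite ge0_integralZl//; last 2 first.
- by apply/measurable_EFinP/measurable_funTS; exact: measurable_exponential_pdf.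
- by rewrite lee_fin invr_ge0 ltW.
have -> : \int[lebesgue_measure]_(r in `[0%R, +oo[)
    (exponential_pdf rate r)%:E = 1.
  rewrite -(integral_exponential_pdf rate_gt0) integral_mkcond.
  apply: eq_integral => r _; rewrite patchE; case: ifPn => //.
  rewrite notin_setE/= in_itv/= andbT => /negP; rewrite -ltNge => r_lt0.
  by rewrite lt0_exponential_pdf.
by rewrite mule1.
Qed.

End ExponentialMean.

(** * A realization of the two sizes on a product space *)

Section PositiveCoordinates.
Variable R : realType.
Local Notation RM := (measurableTypeR R).

Section ExponentialPositive.
Variables (rate : R) (rate_gt0 : 0 < rate).

(* The probability structure of [exponential_prob] depends on [rate_gt0], which
   canonical inference cannot supply. *)
Definition exponential : probability RM R :=
  exponential_distribution_exponential_prob__canonical__probability_measure_Probability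
    rate_gt0.

Lemma exponential_npos : exponential [set` `]-oo, 0%R]] = 0%E.
Proof.
(* Dropping the endpoint 0 leaves only points where the density vanishes. *)
rewrite /= /exponential_prob -integral_itv_bndo_bndc; last first.
  apply/measurable_EFinP/measurable_funTS.
  exact: measurable_exponential_pdf.
apply: integral0_eq => r /=; rewrite in_itv/= => r_lt0.
by rewrite lt0_exponential_pdf.
Qed.

(* A realization must be positive everywhere, not only almost surely. *)
Definition positivize (r : R) : R := if 0 < r then r else 1.

Lemma positivize_gt0 r : 0 < positivize r.
Proof. by rewrite /positivize; case: ifP. Qed.

Lemma measurable_positivize : measurable_fun [set: RM] (positivize : RM -> RM).
Proof. by apply: measurable_fun_ifT => //; exact: measurable_fun_ltr. Qed.

(** [positivize] moves only points of the null set [N], so both sides agree once [N] is removed. *)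
Lemma exponential_positivize (B : set RM) : measurable B ->
  exponential (positivize @^-1` B) = exponential B.
Proof.
move=> mB; pose N : set RM := [set` `]-oo, 0%R]].
have mN : measurable N by exact: measurable_itv.
have mfB : measurable (positivize @^-1` B).
  by rewrite -[X in measurable X]setTI; exact: measurable_positivize.
have splitN (A : set RM) : measurable A ->
    exponential A = exponential (A `\` N).
  move=> mA; rewrite (measureDI exponential mA mN).
  rewrite [X in (_ + X)%E](_ : _ = 0%E) ?adde0//.
  apply: (subset_measure0 _ _ _ exponential_npos) => //.
  exact: measurableI.
rewrite splitN// [RHS]splitN//; congr (exponential _); apply/seteqP.
have notN r : ~ N r -> positivize r = r.
  by move=> /negP; rewrite /= in_itv/= -ltNge /positivize => ->.
by split=> r [Br Nr]; split=> //; move: Br; rewrite /= notN.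
Qed.

End ExponentialPositive.

(** The sources in use are the two sizes of index 0, one per coordinate; all others only have to be
    positive and measurable. *)
Definition sizes (s : source) (w : RM * RM) : R :=
  match s with
  | inl (Inelastic, _) => positivize w.1
  | inl (Elastic, _) => positivize w.2
  | inr _ => 1
  end.

Lemma measurable_sizes s : measurable_fun [set: RM * RM] (sizes s).
Proof.
case: s => [[[] m]|s] //=.
- exact: (measurableT_comp measurable_positivize measurable_fst).
- exact: (measurableT_comp measurable_positivize measurable_snd).
- exact: measurable_cst.
Qed.

HB.instance Definition _ s := @isMeasurableFun.Build _ _ (RM * RM)%type R
  (sizes s) (measurable_sizes s).

Let mu_gt0 := two_jobs_mu_gt0 R.

Let P : probability (RM * RM)%type R :=
  (exponential (mu_gt0 Inelastic) \x exponential (mu_gt0 Elastic))%E.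

Definition draw_sizes (s : source) : {RV P >-> R} := sizes s.

Let first : source := inl (Inelastic, 0%N).
Let second : source := inl (Elastic, 0%N).

Let in_use_two_jobs s : in_use (two_jobs R) s -> s = first \/ s = second.
Proof.
case: s => [[c [|m]]|[c m]] /=; rewrite ?ltxx//.
by case: c => _; [left|right].
Qed.

Let measurable_preimage (B : set R) : measurable B ->
  measurable (positivize @^-1` B : set RM).
Proof.
by move=> mB; rewrite -[X in measurable X]setTI; exact: measurable_positivize.
Qed.

Let P_rect (A1 A2 : set RM) : measurable A1 -> measurable A2 ->
  P (A1 `*` A2) = (exponential (mu_gt0 Inelastic) A1 *
                   exponential (mu_gt0 Elastic) A2)%E.
Proof. by move=> mA1 mA2; exact: product_measure1E. Qed.

Let P_first (B : set R) : measurable B ->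
  P (sizes first @^-1` B) = exponential (mu_gt0 Inelastic) (positivize @^-1` B).
Proof.
move=> mB; rewrite [X in P X](_ : _ = (positivize @^-1` B) `*` setT).
  by rewrite P_rect ?probability_setT ?mule1//; exact: measurable_preimage.
by apply/seteqP; split=> w //= [].
Qed.

Let P_second (B : set R) : measurable B ->
  P (sizes second @^-1` B) = exponential (mu_gt0 Elastic) (positivize @^-1` B).
Proof.
move=> mB; rewrite [X in P X](_ : _ = setT `*` (positivize @^-1` B)).
  by rewrite P_rect ?probability_setT ?mul1e//; exact: measurable_preimage.
by apply/seteqP; split=> w //= [].
Qed.

Lemma sizes_gt0 s w : 0 < sizes s w.
Proof. by case: s => [[[] m]|s] //=; exact: positivize_gt0. Qed.

Lemma sizes_indep : mutually_independent (in_use (two_jobs R)) draw_sizes.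
Proof.
move=> J B uJ /allP useJ mB.
(* Padding with the whole line turns the event into a rectangle whatever [J] is, so the product
   measure factors it. *)
pose part s : set RM := if s \in J then positivize @^-1` B s else setT.
have mpart s : measurable (part s).
  by rewrite /part; case: ifP => // _; exact: measurable_preimage.
have permJ : perm_eq J [seq s <- [:: first; second] | s \in J].
  apply: uniq_perm => //; first exact: filter_uniq.
  move=> s; rewrite mem_filter; case: (boolP (s \in J)) => //= sJ.
  by have [->|->] := in_use_two_jobs (useJ _ sJ); rewrite !inE eqxx ?orbT.
rewrite (perm_big _ permJ) big_filter !big_cons big_nil /=.
rewrite [X in P X](_ : _ = part first `*` part second).
  rewrite P_rect// /part.
  case: ifP => _; case: ifP => _;
    by rewrite ?P_first ?P_second ?probability_setT ?mule1 ?mul1e.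
rewrite /part; apply/seteqP; split=> w /=.
- by move=> JB; split; case: ifP => // /JB.
- move=> [w1 w2] s sJ.
  move: w1 w2 (sJ); have [->|->] := in_use_two_jobs (useJ _ sJ).
  + by move=> + _ /= sJ'; rewrite sJ'.
  + by move=> _ + /= sJ'; rewrite sJ'.
Qed.

Lemma sizes_law s : in_use (two_jobs R) s -> forall B : set R, measurable B ->
  distribution P (draw_sizes s) B = exponential_prob (rate (two_jobs R) s) B.
Proof.
move=> /in_use_two_jobs[]-> B mB; rewrite /distribution /pushforward.
- by rewrite P_first//; exact: (exponential_positivize (mu_gt0 Inelastic)).
- by rewrite P_second//; exact: (exponential_positivize (mu_gt0 Elastic)).
Qed.

Lemma realization_two_jobs : inhabited (realization (two_jobs R) P).
Proof.
by constructor; exact: (Realization sizes_gt0 sizes_law sizes_indep).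
Qed.

End PositiveCoordinates.

(** * Mean response times and their comparison *)

Lemma mean_response_time_two_jobs (R : realType) (pi : policy R 1)
    (c : job_class) :
  alloc pi c 1 1 = 1 -> alloc pi (other c) 1 1 = 0 ->
  alloc pi Inelastic 1 0 = 1 -> alloc pi Elastic 0 1 = 1 ->
  has_mean_response_time (sys := two_jobs R) pi
    ((mu (two_jobs R) c)^-1 + 2^-1 * (mu (two_jobs R) (other c))^-1)%:E.
Proof.
move=> ac ao ai ae; split.
  by do 3 eexists; exact: realization_two_jobs.
move=> d T P W; rewrite /mean_response_time_in /= eqxx /=.
pose X c' : {RV P >-> R} := draw W (inl (c', 0%N)).
have X_ge0 c' w : (0 <= (X c' w)%:E)%E by rewrite lee_fin ltW ?draw_gt0.
have mX c' : measurable_fun setT (EFin \o X c').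
  exact/measurable_EFinP.
have EX c' : (\int[P]_w (X c' w)%:E)%E = ((mu (two_jobs R) c')^-1)%:E.
  rewrite -expectation_def; apply: expectation_exponential.
  - exact: mu_gt0.
  - by move=> w; exact: draw_gt0.
  - by move=> B mB; rewrite draw_law.
(* Pathwise, the average of [X c] and [X c + X (other c)] is [X c] plus half of [X (other c)]. *)
transitivity (\int[P]_w ((X c w)%:E + (2^-1)%:E * (X (other c) w)%:E))%E.
  have half_ge0 : (0 <= (2^-1)%:E :> \bar R)%E by rewrite lee_fin invr_ge0.
  rewrite ge0_integralD//; first last.
  - by apply: measurable_funeM; exact: mX.
  - by move=> w _; rewrite mule_ge0.
  - exact: mX.
  by rewrite ge0_integralZl ?EX//; exact: mX.
apply: eq_integral => w _.
rewrite /initial_jobs /= !big_ord_recl big_ord0 adde0.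
have r_first := response_time_served_first ac ao ai ae (fun s => W s w).
have r_last := response_time_served_last ac ao ai ae (fun s => W s w).
(* Job 0 is the one served first or last according to [c]; the sum is the same up to order. *)
have -> : (response_time (sys := two_jobs R) pi (fun s => W s w) 0 +
    response_time (sys := two_jobs R) pi (fun s => W s w) 1 =
    (X c w + (X c w + X (other c) w))%:E)%E.
  by case: c r_first r_last {ac ao} => /= -> ->; rewrite // addrC.
rewrite -!EFinM -[LHS]EFinD; congr EFin.
by field.
Qed.

Theorem theorem6 (R : realType) :
  exists sys : instance R,
    (mu sys Inelastic < mu sys Elastic)%R /\
    exists (pi : policy R (servers sys)) (r_pi r_IF : \bar R),
      has_mean_response_time pi r_pi /\
      has_mean_response_time (inelastic_first R (servers sys)) r_IF /\
      (r_pi < r_IF)%E.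
Proof.
exists (two_jobs R); split; first by rewrite /= ltr1n.
exists (elastic_first R 1); do 2 eexists; split; [|split].
- exact: (mean_response_time_two_jobs (c := Elastic)).
- exact: (mean_response_time_two_jobs (c := Inelastic)).
(* The values are 1/2 + 1/2 = 1 for Elastic-First and 1 + 1/4 = 5/4 for Inelastic-First. *)
- by rewrite lte_fin /=; lra.
Qed.
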